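(* Let $N\ge 2$ and $M\ge 1$ be integers, let $\theta_1,\dots,\theta_M\in[0,\pi]$, and let $u_0\in S^{N-1}$ be a fixed point. Let $u_0,u_1,\dots,u_M$ be the Markov chain on $S^{N-1}$ in which, for each $i=1,\dots,M$, given $u_0,\dots,u_{i-1}$, the point $u_i$ is uniformly distributed on $\Sigma(u_{i-1},\theta_i)$. Then $$\mathbb{E}\left[\langle u_M,u_0\rangle\right]=\prod_{i=1}^M\cos\theta_i ,$$ and the standard deviation $\sigma$ of the random variable $\langle u_M,u_0\rangle$ satisfies $$\sigma^2=\frac1{N-1}\sum_{j=1}^{M-1}\sin^2\theta_j\left(1-\prod_{i=j+1}^M\cos^2\theta_i\right)\prod_{i=1}^{j-1}\left(\cos^2\theta_i-\frac1{N-1}\sin^2\theta_i\right)$$ and $$\sigma\le\frac1{\sqrt{N-1}}\left(\sum_{j=1}^{M-1}\sin^2\theta_j\right)^{1/2}.$$ (Empty products are $1$ and empty sums are $0$.)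
   Context: $S^{N-1}$ is the unit sphere of the Euclidean space $\mathbb{R}^N$ with standard inner product $\langle\cdot,\cdot\rangle$. For $u\in S^{N-1}$ and $\theta\in[0,\pi]$, $$\Sigma(u,\theta):=\{\cos\theta\cdot u+\sin\theta\cdot w : w\in S^{N-2}_{u^\perp}\},$$ where $S^{N-2}_{u^\perp}=\{w\in\mathbb{R}^N:\langle w,u\rangle=0,\ \|w\|=1\}$ is the unit sphere of the hyperplane orthogonal to $u$; thus $\Sigma(u,\theta)$ is the set of points of $S^{N-1}$ at angular distance $\theta$ from $u$. ''Uniformly distributed on $\Sigma(u,\theta)$'' means distributed as $\cos\theta\cdot u+\sin\theta\cdot w$ with $w$ distributed according to the rotation-invariant probability measure on $S^{N-2}_{u^\perp}$ (for $N=2$, the uniform measure on two points). *)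

(* Defs.v *)
From HB Require Import structures.
From mathcomp Require Import all_boot all_order all_algebra.
From mathcomp Require Import all_classical all_reals all_analysis.

Set Implicit Arguments.
Unset Strict Implicit.
Unset Printing Implicit Defensive.
Import Order.TTheory GRing.Theory Num.Theory.
Import numFieldNormedType.Exports.
Local Open Scope classical_set_scope.
Local Open Scope ring_scope.

(* R^N with its Borel sigma-algebra; convertible to 'rV[R]_N.  The library
   topology of 'rV[R]_N is that of the sup norm, i.e. the Euclidean one. *)
Definition Rn (R : realType) (N : nat) :=
  g_sigma_algebraType (@open 'rV[R]_N).

(* The library norm on 'rV[R]_N is the sup norm, so the sphere is defined
   below through the inner product. *)
Definition dot (R : realType) (N : nat) (x y : 'rV[R]_N) : R :=
  \sum_(i < N) x ord0 i * y ord0 i.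

(* S^{N-1}: |x| = 1 is written <x, x> = 1. *)
Definition sphere (R : realType) (N : nat) : set (Rn R N) :=
  [set x | dot x x = 1].

(* S^{N-2}_{u^perp} *)
Definition sphere_perp (R : realType) (N : nat) (u : 'rV[R]_N) :
    set (Rn R N) :=
  [set w | dot w u = 0 /\ dot w w = 1].

Definition orthogonal_mx (R : realType) (N : nat) (Q : 'M[R]_N) : Prop :=
  Q *m Q^T = 1%:M.

(* nu is the rotation-invariant probability measure on S^{N-2}_{u^perp}, seen
   as a measure on R^N.  The isometries of the hyperplane u^perp are exactly
   the restrictions of the orthogonal maps of R^N fixing u; orientation-reversing
   ones are included, so that for N = 2 (where u^perp is a line) nu is the
   uniform measure on two points. *)
Definition uniform_sphere_perp (R : realType) (N : nat) (u : 'rV[R]_N)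
    (nu : probability (Rn R N) R) : Prop :=
  nu (sphere_perp u) = 1%E /\
  forall Q : 'M[R]_N, orthogonal_mx Q -> u *m Q = u ->
    forall B : set (Rn R N), measurable B ->
      nu [set w : Rn R N | B (w *m Q)] = nu B.

(* mu is the law of cos theta u + sin theta w, w uniform on S^{N-2}_{u^perp}. *)
Definition uniform_Sigma (R : realType) (N : nat) (u : 'rV[R]_N) (theta : R)
    (mu : set (Rn R N) -> \bar R) : Prop :=
  exists2 nu : probability (Rn R N) R, uniform_sphere_perp u nu &
    forall B : set (Rn R N), measurable B ->
      mu B = nu [set w : Rn R N | B (cos theta *: u + sin theta *: w)].

(* k w is the conditional law of X given the sub-sigma-algebra F, at the
   outcome w.  (F-measurability of w |-> k w B has to come from the form of k;
   below, k is a kernel composed with an F-measurable variable.) *)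
Definition conditional_law (R : realType) (d d' : measure_display)
    (Omega : measurableType d) (T : measurableType d')
    (P : probability Omega R) (F : set (set Omega)) (X : Omega -> T)
    (k : Omega -> set T -> \bar R) : Prop :=
  forall (A : set Omega) (B : set T), F A -> measurable B ->
    P (A `&` X @^-1` B) = (\int[P]_(w in A) k w B)%E.

(* The chain u_0, ..., u_M on S^{N-1}.  The sequences u and theta are indexed by
   nat, but only u_0, ..., u_M and theta_1, ..., theta_M are constrained.  The
   transition kernel K lives on R^N, but only its values on S^{N-1} matter. *)
Definition sphere_chain (R : realType) (N M : nat) (d : measure_display)
    (Omega : measurableType d) (P : probability Omega R)
    (theta : nat -> R) (u0 : 'rV[R]_N)
    (u : nat -> {RV P >-> Rn R N}) : Prop :=
  [/\ forall w, u 0%N w = u0,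
      forall (i : nat) w, (i <= M)%N -> sphere (u i w) &
      forall i : nat, (i < M)%N -> exists K : R.-pker (Rn R N) ~> (Rn R N),
        (forall x : Rn R N, sphere x -> uniform_Sigma x (theta i.+1) (K x)) /\
        conditional_law P
          (g_sigma_preimage (fun k : 'I_i.+1 => u k : Omega -> Rn R N))
          (u i.+1) (fun w => K (u i w))].

Definition std_dev (R : realType) (d : measure_display)
    (Omega : measurableType d) (P : probability Omega R) (X : Omega -> R) :
    \bar R :=
  sqrte ('V_P[X])%E.

(* Main.v *)
Require Import Defs.
From HB Require Import structures.
From mathcomp Require Import all_boot all_order all_algebra.
From mathcomp Require Import all_classical all_reals all_analysis.
From mathcomp Require Import measurable_realfun giry ring lra.
Import Order.TTheory GRing.Theory Num.Theory.
Import numFieldNormedType.Exports.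
Local Open Scope classical_set_scope.
Local Open Scope ring_scope.

(** Let X_i be the inner product of u_i and u_0.  Given u_(i-1), the point u_i
    is cos theta_i u_(i-1) + sin theta_i w, with w uniform on the unit sphere
    of the hyperplane orthogonal to u_(i-1).  Symmetry alone determines the
    first two moments of w: its law is invariant under the central symmetry of
    the hyperplane, so its mean is 0 ([uniform_mean]), and under reflections,
    so its second moment form is a multiple of the squared norm on the
    hyperplane, the multiple 1 / (N - 1) being found by taking a trace
    ([uniform_second_moment]).  Consequently ([projection_momentsS])

      E X_i   = cos theta_i E X_(i-1),
      E X_i^2 = n s_i + (a_i - n s_i) E X_(i-1)^2,

    where a_i = cos^2 theta_i, s_i = sin^2 theta_i and n = 1 / (N - 1).  The
    first recursion is a product; subtracting from the solution of the second
    one the square of the mean, which is the product of the a_i, gives the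
    announced sum by telescoping ([second_moment_recursion]).  Every summand is
    at most s_j ([variance_formula_le]), whence the bound on the standard
    deviation. *)

Set Implicit Arguments.
Unset Strict Implicit.
Unset Printing Implicit Defensive.

(** * Integrating against a conditional law *)

Section subprobability_of.
Context (R : realType) (d : measure_display) (T : measurableType d).
Variables (mu : {measure set T -> \bar R}) (mu1 : (mu setT <= 1)%E).

(** A constant on which to declare the subprobability structure, as a canonical
    structure cannot be attached to the variable [mu]. *)
Definition subprobability_of_fun : set T -> \bar R := mu.

HB.instance Definition _ := Measure.on subprobability_of_fun.

HB.instance Definition _ :=
  Measure_isSubProbability.Build _ _ _ subprobability_of_fun mu1.

Definition subprobability_of : giry T R := subprobability_of_fun.

End subprobability_of.

(** Taking the conditioning event to be the whole space, the law of [Y] is the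
    mixture of the kernel [K] along the law of [X], that is a bind of the Giry
    monad; the claim is then the associativity of integration for this bind. *)
Lemma integral_conditional_law (R : realType) (d d1 d2 : measure_display)
    (Omega : measurableType d) (T1 : measurableType d1) (T2 : measurableType d2)
    (P : probability Omega R) (F : set (set Omega)) (X : {RV P >-> T1})
    (Y : {RV P >-> T2}) (K : R.-pker T1 ~> T2) (f : T2 -> \bar R) :
  F setT -> conditional_law P F Y (fun w => K (X w)) ->
  measurable_fun setT f -> (forall y, (0 <= f y)%E) ->
  (\int[P]_w f (Y w) = \int[P]_w \int[K (X w)]_y f y)%E.
Proof.
move=> FT lawY mf f0.
pose k (w : Omega) := subprobability_of (sprob_kernel_le1 K (X w)).
have mk : measurable_fun setT k.
  apply: measurable_giry_codensity => // B mB.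
  exact: (measurableT_comp (measurable_kernel K B mB)).
rewrite -[RHS](giry_int_bind _ mk mf f0) -ge0_integral_distribution//.
apply: eq_measure_integral => B mB _.
transitivity (P (setT `&` Y @^-1` B)); first by rewrite setTI.
rewrite lawY//.
by rewrite /giry_bind /= [RHS]giry_int_map//; exact: measurable_giry_ev.
Qed.

(** * Borel measurability on R^N *)

Section measurability.
Variables (R : realType) (N : nat).

Lemma measurable_coord (i : 'I_N) :
  measurable_fun setT (fun w : Rn R N => w ord0 i : R).
Proof.
apply: (measurability (@RGenOInfty.G R)).
  exact: RGenOInfty.measurableE.
move=> _ [_ [x ->] <-]; rewrite setTI.
apply: sub_sigma_algebra.
apply: open_comp; last exact: interval_open.
by move=> w _; exact: coord_continuous.
Qed.

Lemma measurable_dot (v : 'rV[R]_N) :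
  measurable_fun setT (fun w : Rn R N => dot w v).
Proof.
apply: measurable_sum => i; apply: measurable_funM => //.
exact: measurable_coord.
Qed.

Lemma continuous_affine (a : 'rV[R]_N) (Q : 'M[R]_N) :
  continuous (fun w : 'rV[R]_N => a + w *m Q).
Proof.
pose f (x : 'rV[R]_N) : 'rV[R]_N := a + x *m Q.
have cf j : continuous (fun x => f x ord0 j).
  rewrite (_ : (fun x => _) =
    fun x : 'rV[R]_N => a ord0 j + \sum_i x ord0 i * Q i j).
    move=> x; apply: continuousD; first exact: cst_continuous.
    apply: continuous_big; first exact: add_continuous.
    move=> i _ y; apply: continuousM; last exact: cst_continuous.
    exact: coord_continuous.
  by apply/funext => x; rewrite !mxE.
(* the balls of 'rV[R]_N are defined coordinatewise *)
have nearf (w : 'rV[R]_N) e : 0 < e ->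
    \forall x \near w, forall j, ball (f w ord0 j) e (f x ord0 j).
  move=> e0; apply: (@filter_forall _ _ _ _ (nbhs_filter (w : 'rV[R]_N))) => j;
  exact: (cf j w _ (nbhsx_ballx (f w ord0 j) e e0)).
move=> w U /= /(nbhs_ballP (f w)) [e /= e0 eU].
apply: (@filterS _ _ (nbhs_filter (w : 'rV[R]_N)) _ _ _ (nearf w e e0)).
move=> x fx; apply: eU; split => // i j.
by rewrite ord1; exact: fx.
Qed.

Lemma measurable_affine (a : 'rV[R]_N) (Q : 'M[R]_N) :
  measurable_fun [set: Rn R N] (fun w : Rn R N => (a + w *m Q : Rn R N)).
Proof.
apply: (@measurability _ _ (Rn R N) (Rn R N) _ _ (@open 'rV[R]_N)) => //.
move=> _ [U oU <-].
rewrite setTI; apply: sub_sigma_algebra; apply: open_comp oU => w _.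
exact: continuous_affine.
Qed.

Lemma measurable_sphere_perp (u : 'rV[R]_N) :
  measurable (sphere_perp u : set (Rn R N)).
Proof.
rewrite (_ : sphere_perp u =
  [set w : Rn R N | dot w u = 0] `&` [set w : Rn R N | dot w w = 1])//.
apply: measurableI.
  rewrite -[X in measurable X]setTI.
  exact: (measurable_dot u measurableT (measurable_set1 0)).
rewrite -[X in measurable X]setTI.
have m : measurable_fun setT (fun w : Rn R N => dot w w).
  apply: measurable_sum => i.
  by apply: measurable_funM; exact: measurable_coord.
exact: (m measurableT _ (measurable_set1 1)).
Qed.

End measurability.

(** * Inner product and hyperplane reflections *)

Section dot.
Variables (R : realType) (N : nat).
Implicit Types (x y z : 'rV[R]_N).

Lemma dotE x y : dot x y = (x *m y^T) ord0 ord0.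
Proof. by rewrite mxE; apply: eq_bigr => i _; rewrite mxE. Qed.

Lemma dotC x y : dot x y = dot y x.
Proof. by apply: eq_bigr => i _; rewrite mulrC. Qed.

Lemma dotDl x y z : dot (x + y) z = dot x z + dot y z.
Proof. by rewrite !dotE mulmxDl mxE. Qed.

Lemma dotZl a x z : dot (a *: x) z = a * dot x z.
Proof. by rewrite !dotE -scalemxAl mxE. Qed.

Lemma dotBl x y z : dot (x - y) z = dot x z - dot y z.
Proof. by rewrite -scaleN1r dotDl dotZl mulN1r. Qed.

Lemma dotBr x y z : dot z (x - y) = dot z x - dot z y.
Proof. by rewrite dotC dotBl !(dotC z). Qed.

Lemma dotZr a x z : dot z (a *: x) = a * dot z x.
Proof. by rewrite dotC dotZl dotC. Qed.

Lemma dot_mulmxl x y (Q : 'M[R]_N) : dot (x *m Q) y = dot x (y *m Q^T).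
Proof. by rewrite !dotE trmx_mul trmxK mulmxA. Qed.

Lemma dotxx_ge0 x : 0 <= dot x x.
Proof. by apply: sumr_ge0 => i _; rewrite -expr2 sqr_ge0. Qed.

Lemma dotxx_eq0 x : dot x x = 0 -> x = 0.
Proof.
move=> /eqP; rewrite psumr_eq0; last by move=> i _; rewrite -expr2 sqr_ge0.
move=> /allP x0; apply/rowP => i; rewrite mxE; apply/eqP.
by have := x0 i (mem_index_enum _); rewrite -expr2 sqrf_eq0.
Qed.

Lemma dot_delta x i : dot x (delta_mx ord0 i) = x ord0 i.
Proof.
rewrite /dot (bigD1 i)//= mxE !eqxx mulr1 big1 ?addr0// => j ji.
by rewrite mxE eqxx (negPf ji) mulr0.
Qed.

Lemma sqr_coord_le x i : x ord0 i ^+ 2 <= dot x x.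
Proof.
rewrite /dot (bigD1 i)//= -expr2 lerDl.
by apply: sumr_ge0 => j _; rewrite -expr2 sqr_ge0.
Qed.

(** The constant is the l^1 norm of [v], as coordinates are at most 1 in
    absolute value on the sphere.  This bound gives integrability. *)
Lemma dot_bounded (v : 'rV[R]_N) :
  exists C : R, forall x, dot x x = 1 -> `|dot x v| <= C.
Proof.
exists (\sum_i `|v ord0 i|) => x xx.
apply: (le_trans (ler_norm_sum _ _ _)); apply: ler_sum => i _.
rewrite normrM ler_piMl// -[leRHS]sqrtr1 -sqrtr_sqr ler_wsqrtr//.
by rewrite -xx sqr_coord_le.
Qed.

(** The reflection across the hyperplane orthogonal to [g].  For [g = 0] the
    convention [0^-1 = 0] makes it the identity, which is orthogonal too. *)
Definition householder (g : 'rV[R]_N) : 'M[R]_N :=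
  1%:M - (2 / dot g g) *: (g^T *m g).

Lemma mul_householder g x :
  x *m householder g = x - (2 * dot x g / dot g g) *: g.
Proof.
rewrite mulmxBr mulmx1 -scalemxAr mulmxA [x *m g^T]mx11_scalar -dotE.
by rewrite mul_scalar_mx scalerA mulrAC.
Qed.

Lemma tr_householder g : (householder g)^T = householder g.
Proof. by rewrite linearB /= trmx1 linearZ /= trmx_mul trmxK. Qed.

Lemma householder_orthogonal g : orthogonal_mx (householder g).
Proof.
rewrite /orthogonal_mx tr_householder; apply/row_matrixP => i.
rewrite row_mul [row i (householder g)]rowE !mul_householder row1.
set e := delta_mx _ _. have [g0|g0] := eqVneq (dot g g) 0.
  by rewrite (dotxx_eq0 g0) !scaler0 !subr0.
rewrite -addrA -opprD -scalerDl dotBl dotZl.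
rewrite [X in X *: _](_ : _ = 0) ?scale0r ?subr0//; field => //.
Qed.

(** [x] and [y] have the same norm, so they are mirror images with respect to
    the bisecting hyperplane, the one orthogonal to [x - y]. *)
Lemma householder_swap x y : dot x x = dot y y -> x *m householder (x - y) = y.
Proof.
move=> xy; rewrite mul_householder.
have [g0|g0] := eqVneq (dot (x - y) (x - y)) 0.
  have -> : x = y by apply/eqP; rewrite -subr_eq0 (dotxx_eq0 g0).
  by rewrite subrr scaler0 subr0.
rewrite (_ : 2 * _ / _ = 1) ?scale1r ?subKr//.
apply: (mulIf g0); rewrite divfK// mul1r dotBl !dotBr -xy (dotC y x); ring.
Qed.

End dot.

(** * Bounded functions on an event of probability one *)

Section bounded.
Context (R : realType) (d : measure_display) (T : measurableType d).
Variables (P : probability T R) (D : set T).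
Hypotheses (mD : measurable D)
  (PD : (P : {measure set T -> \bar R}) D = 1%E).

Lemma integrable_bounded (f : T -> R) (C : R) :
  measurable_fun setT f -> (forall w, D w -> `|f w| <= C) ->
  P.-integrable D (EFin \o f).
Proof.
move=> mf fC; apply: measurable_bounded_integrable => //.
- exact: le_lt_trans (probability_le1 P mD) (ltry 1).
- exact: measurable_funTS.
- exists C; split; first exact: num_real.
  by move=> x Cx w Dw; exact: le_trans (fC w Dw) (ltW Cx).
Qed.

Lemma integrable_bounded_sqr (f : T -> R) (C : R) :
  measurable_fun setT f -> (forall w, D w -> `|f w| <= C) ->
  P.-integrable D (EFin \o (fun w => f w ^+ 2)).
Proof.
move=> mf fC; apply: (@integrable_bounded _ (C ^+ 2)).
  exact: measurable_funX.
move=> w Dw; rewrite normrX lerXn2r// ?fC// nnegrE.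
exact: le_trans (fC w Dw).
Qed.

(** Integrals of quadratic polynomials in a bounded variable only involve its
    first two moments.  Integrating over an almost sure event [D] allows the
    bound to hold on [D] only. *)
Lemma integral_quadratic (X : T -> R) (C a b c : R) :
  measurable_fun setT X -> (forall w, D w -> `|X w| <= C) ->
  (\int[P]_(w in D) (a + (b * X w + c * X w ^+ 2))%:E)%E =
  (a + (b * \int[P]_(w in D) X w + c * \int[P]_(w in D) X w ^+ 2))%:E.
Proof.
move=> mX XC; have iX := integrable_bounded mX XC.
have iX2 := integrable_bounded_sqr mX XC.
have ia : P.-integrable D (EFin \o (fun=> a)).
  by apply: (@integrable_bounded _ `|a|) => // w _.
have iZ k g : P.-integrable D (EFin \o g) ->
    P.-integrable D (EFin \o (fun w => k * g w)).
  by move=> ig; have := integrableZl mD k ig.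
have iD g h : P.-integrable D (EFin \o g) -> P.-integrable D (EFin \o h) ->
    P.-integrable D (EFin \o (fun w => g w + h w)).
  by move=> ig ih; have := integrableD mD ig ih.
rewrite -[LHS]fineK; last first.
  by apply: (integrable_fin_num mD); apply: (iD) => //; apply: (iD); exact: iZ.
congr EFin; rewrite -/(Rintegral _ _ _) RintegralD//; last first.
  by apply: iD; exact: iZ.
rewrite RintegralD//; [|exact: iZ..].
by rewrite !RintegralZl// Rintegral_cst// PD mulr1.
Qed.

End bounded.

(** * First two moments of the uniform law on the sphere of a hyperplane *)

Section uniform.
Variables (R : realType) (N : nat) (u : 'rV[R]_N).
Hypothesis uu : dot u u = 1.
Variable nu : probability (Rn R N) R.
Hypothesis nuP : uniform_sphere_perp u nu.

Local Notation D := (sphere_perp u).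
Let mD : measurable D := measurable_sphere_perp u.
Let nuD : (nu : {measure set (Rn R N) -> \bar R}) D = 1%E := nuP.1.

Lemma sphere_perp_mulmx (Q : 'M[R]_N) (w : Rn R N) :
  orthogonal_mx Q -> u *m Q = u -> D (w *m Q) = D w.
Proof.
move=> QQ uQ; rewrite /sphere_perp /=.
have dotQ x y : dot (x *m Q) (y *m Q) = dot x y.
  by rewrite dot_mulmxl -mulmxA QQ mulmx1.
by rewrite -{1}uQ !dotQ.
Qed.

(** Both the measure and the sphere of the hyperplane are preserved by an
    orthogonal map that fixes [u]. *)
Lemma Rintegral_sphere_perp_mulmx (Q : 'M[R]_N) (f : Rn R N -> R) :
  orthogonal_mx Q -> u *m Q = u -> measurable_fun setT f ->
  nu.-integrable D (fun w => (f (w *m Q))%:E) ->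
  \int[nu]_(w in D) f (w *m Q) = \int[nu]_(w in D) f w.
Proof.
move=> QQ uQ mf intf; pose phi (w : Rn R N) : Rn R N := w *m Q.
have mphi : measurable_fun setT phi.
  rewrite (_ : phi = fun w => 0 + w *m Q); first exact: measurable_affine.
  by apply/funext => w; rewrite add0r.
have phiD : phi @^-1` D = D.
  by apply/funext => w; rewrite /preimage /= sphere_perp_mulmx.
congr fine; transitivity (\int[pushforward nu phi]_(w in D) (f w)%:E)%E.
  by rewrite integral_pushforward ?phiD//; exact/measurable_EFinP.
by apply: eq_measure_integral => B mB _; exact: nuP.2.
Qed.

Lemma Rintegral_sphere_perp_sum (I : Type) (r : seq I) (f : I -> Rn R N -> R) :
  (forall i, nu.-integrable D (EFin \o f i)) ->
  \int[nu]_(w in D) (\sum_(i <- r) f i w) =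
  \sum_(i <- r) \int[nu]_(w in D) f i w.
Proof.
move=> intf; rewrite /Rintegral.
under eq_integral do rewrite -sumEFin.
rewrite integral_sum//= -sum_fine//.
by move=> i _; exact: (integrable_fin_num mD (intf i)).
Qed.

Lemma dot_sphere_perp_bounded (v : 'rV[R]_N) :
  exists C : R, forall w, D w -> `|dot w v| <= C.
Proof. by have [C vC] := dot_bounded v; exists C => w [_ /vC]. Qed.

Lemma integrable_dot v : nu.-integrable D (fun w => (dot w v)%:E).
Proof.
have [C vC] := dot_sphere_perp_bounded v.
exact: (integrable_bounded nu mD (measurable_dot v) vC).
Qed.

Lemma integrable_dot_sqr v : nu.-integrable D (fun w => (dot w v ^+ 2)%:E).
Proof.
have [C vC] := dot_sphere_perp_bounded v.
exact: (integrable_bounded_sqr nu mD (measurable_dot v) vC).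
Qed.

(** The opposite of the reflection along [u] fixes [u] and is the central
    symmetry of the orthogonal hyperplane, so the integral equals its
    opposite. *)
Lemma uniform_mean v : \int[nu]_(w in D) dot w v = 0.
Proof.
have QQ : orthogonal_mx (- householder u).
  rewrite /orthogonal_mx linearN /= mulNmx mulmxN opprK.
  exact: householder_orthogonal.
have uQ : u *m (- householder u) = u.
  rewrite mulmxN mul_householder uu divr1 mulr1 -{1}[u]scale1r -scalerBl.
  by rewrite -scaleNr (_ : - _ = 1) ?scale1r//; ring.
have intQ : nu.-integrable D
    (fun w : Rn R N => (dot (w *m (- householder u)) v)%:E).
  by under eq_fun do rewrite dot_mulmxl; exact: integrable_dot.
have := Rintegral_sphere_perp_mulmx QQ uQ (measurable_dot v) intQ.
rewrite (@eq_Rintegral _ _ _ _ _ (fun w : Rn R N => -1 * dot w v)); last first.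
  move=> w /set_mem [wu _]; rewrite mulmxN mul_householder wu mulr0 mul0r.
  by rewrite scale0r subr0 -scaleN1r dotZl.
rewrite RintegralZl//; last exact: integrable_dot.
by lra.
Qed.

(* The second moment form of the uniform law. *)
Let q v := \int[nu]_(w in D) dot w v ^+ 2.

Let qZ a v : q (a *: v) = a ^+ 2 * q v.
Proof.
rewrite /q -RintegralZl//; last exact: integrable_dot_sqr.
by apply: eq_Rintegral => w _; rewrite dotZr exprMn.
Qed.

Let q_proj v : q v = q (v - dot v u *: u).
Proof.
apply: eq_Rintegral => w /set_mem [wu _].
by rewrite dotBr dotZr wu mulr0 subr0.
Qed.

(* The reflection exchanging x and y fixes u, since x - y is orthogonal to u. *)
Let q_isotropic x y :
  dot x u = 0 -> dot y u = 0 -> dot x x = dot y y -> q x = q y.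
Proof.
move=> xu yu xy; pose Q := householder (x - y).
have QQ : orthogonal_mx Q by exact: householder_orthogonal.
have uQ : u *m Q = u.
  by rewrite mul_householder dotC dotBl xu yu subr0 mulr0 mul0r scale0r subr0.
have dotQ (w : Rn R N) : dot (w *m Q) x = dot w y.
  by rewrite dot_mulmxl tr_householder householder_swap.
have mx2 : measurable_fun setT (fun w : Rn R N => dot w x ^+ 2).
  by apply: measurable_funX; exact: measurable_dot.
rewrite /q -(Rintegral_sphere_perp_mulmx QQ uQ mx2); last first.
  by under eq_fun do rewrite dotQ; exact: integrable_dot_sqr.
by apply: eq_Rintegral => w _; rewrite dotQ.
Qed.

(* Isotropy applied to x and y rescaled to the common norm |x||y|. *)
Let q_homogeneous x y : dot x u = 0 -> dot y u = 0 ->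
  q x * dot y y = q y * dot x x.
Proof.
move=> xu yu; rewrite -(sqr_sqrtr (dotxx_ge0 x)) -(sqr_sqrtr (dotxx_ge0 y)).
rewrite mulrC -qZ [RHS]mulrC -qZ; apply: q_isotropic.
- by rewrite dotZl xu mulr0.
- by rewrite dotZl yu mulr0.
- rewrite !(dotZl, dotZr) !mulrA -!expr2 !sqr_sqrtr ?dotxx_ge0//; ring.
Qed.

(* The trace of q is the integral of the squared norm. *)
Let q_trace : \sum_i q (delta_mx ord0 i) = 1.
Proof.
rewrite -Rintegral_sphere_perp_sum; last by move=> i; exact: integrable_dot_sqr.
rewrite (@eq_Rintegral _ _ _ _ _ (fun=> 1 : R)); last first.
  move=> w /set_mem [_ <-]; apply: eq_bigr => i _.
  by rewrite dot_delta expr2.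
by rewrite Rintegral_cst// nuD mul1r.
Qed.

(** By isotropy, [q] is a multiple of the squared norm on the hyperplane.
    Instead of introducing an orthonormal basis of the hyperplane, [q v] is
    compared with [q] at the projections of the canonical basis of R^N: the
    squared norms of these projections, [1 - u_i^2], add up to [N - 1], while
    the values of [q] add up to its trace, which is 1. *)
Lemma uniform_second_moment v : (N%:R - 1) *
  \int[nu]_(w in D) dot w v ^+ 2 = dot v v - dot v u ^+ 2.
Proof.
pose p x := x - dot x u *: u.
have pu x : dot (p x) u = 0 by rewrite dotBl dotZl uu mulr1 subrr.
have pp x : dot (p x) (p x) = dot x x - dot x u ^+ 2.
  rewrite {2}/p dotBr dotZr pu mulr0 subr0 dotBl dotZl (dotC u x); ring.
rewrite -/(q v) -pp -[RHS]mul1r -[X in _ = X * _]q_trace mulr_suml.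
have qp i : q (delta_mx ord0 i) * dot (p v) (p v) =
    q v * (dot (delta_mx ord0 i) (delta_mx ord0 i) -
           dot (delta_mx ord0 i) u ^+ 2).
  by rewrite (q_proj v) q_proj -!/(p _) q_homogeneous// pp.
rewrite (eq_bigr _ (fun i _ => qp i)) -mulr_sumr mulrC; congr (_ * _).
rewrite sumrB -[X in _ - X]uu; congr (_ - _); last first.
  by apply: eq_bigr => i _; rewrite dotC dot_delta expr2.
under eq_bigr do rewrite dot_delta mxE !eqxx.
by rewrite sumr_const card_ord.
Qed.

End uniform.

(** * One step of the walk *)

Section step.
Variables (R : realType) (N : nat).
Hypothesis N2 : (2 <= N)%N.

Let N1 : N%:R - 1 != 0 :> R.
Proof. by rewrite subr_eq0 (eqr_nat R N 1) gtn_eqF. Qed.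

(** The square of a shifted linear form is chosen as test function because it
    is nonnegative, so that its integral makes sense for every measure, and
    because letting [t] vary gives both the mean and the second moment. *)
Lemma integral_uniform_Sigma (u v : 'rV[R]_N) (theta t : R)
    (mu : {measure set (Rn R N) -> \bar R}) :
  dot u u = 1 -> uniform_Sigma u theta mu ->
  (\int[mu]_y ((dot y v + t) ^+ 2)%:E)%E =
  ((cos theta * dot u v + t) ^+ 2 +
   (N%:R - 1)^-1 * sin theta ^+ 2 * (dot v v - dot v u ^+ 2))%:E.
Proof.
move=> uu [nu nuP muE].
have nuD : (nu : {measure set (Rn R N) -> \bar R}) (sphere_perp u) = 1%E.
  exact: nuP.1.
have mD := @measurable_sphere_perp R N u.
pose phi (w : Rn R N) : Rn R N := cos theta *: u + sin theta *: w.
have mphi : measurable_fun setT phi.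
  rewrite (_ : phi = fun w => cos theta *: u + w *m (sin theta)%:M).
    exact: measurable_affine.
  by apply/funext => w; rewrite mul_mx_scalar.
have msqr : measurable_fun setT (fun y : Rn R N => ((dot y v + t) ^+ 2)%:E).
  apply/measurable_EFinP/measurable_funX/measurable_funD => //.
  exact: measurable_dot.
(* mu is the image of nu under the affine map phi, and nu lives on the sphere
   of the hyperplane *)
transitivity (\int[pushforward nu phi]_y ((dot y v + t) ^+ 2)%:E)%E.
  by apply: eq_measure_integral => B mB _; exact: muE.
rewrite ge0_integral_pushforward//; last by move=> y _; rewrite lee_fin sqr_ge0.
rewrite preimage_setT (@ge0_negligible_integral _ _ _ _ _ (~` sphere_perp u));
  last 5 first.
- exact: measurableC.
- by [].
- exact: measurableT_comp.
- by move=> w _; rewrite lee_fin sqr_ge0.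
- by rewrite [LHS](probability_setC nu mD) [X in (1 - X)%E]nuD subee.
rewrite setTD setCK; pose a := cos theta * dot u v + t.
have [C vC] := dot_sphere_perp_bounded u v.
transitivity (\int[nu]_(w in sphere_perp u)
    (a ^+ 2 + (2 * a * sin theta * dot w v +
               sin theta ^+ 2 * dot w v ^+ 2))%:E)%E.
  apply: eq_integral => w _; congr EFin; rewrite /= /phi dotDl !dotZl /a; ring.
rewrite (integral_quadratic mD nuD _ _ _ (measurable_dot v) vC).
rewrite (uniform_mean uu nuP) mulr0 add0r -(uniform_second_moment uu nuP).
by congr EFin; rewrite -/a; field.
Qed.

End step.

(** * Moments of the projection of the chain *)

Section chain.
Context (R : realType) (N M : nat) (d : measure_display).
Context (Omega : measurableType d) (P : probability Omega R).
Variables (theta : nat -> R) (u0 : 'rV[R]_N) (u : nat -> {RV P >-> Rn R N}).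
Hypotheses (N2 : (2 <= N)%N) (u0S : dot u0 u0 = 1).
Hypothesis uC : sphere_chain M theta u0 u.

Let X i w := dot (u i w) u0.
Let P1 : (P : {measure set Omega -> \bar R}) setT = 1%E := probability_setT P.

Lemma measurable_projection i : measurable_fun setT (X i).
Proof. exact: (measurableT_comp (measurable_dot u0)). Qed.

Lemma projection_bounded i : (i <= M)%N ->
  exists C : R, forall w, setT w -> `|X i w| <= C.
Proof.
move=> iM; have [C vC] := dot_bounded u0; exists C => w _.
by apply: vC; have [_ uS _] := uC; exact: uS.
Qed.

Lemma integral_projection_sqr i t : (i <= M)%N ->
  (\int[P]_w ((X i w + t) ^+ 2)%:E)%E =
  (t ^+ 2 + (2 * t * \int[P]_w X i w + \int[P]_w X i w ^+ 2))%:E.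
Proof.
move=> iM; have [C XC] := projection_bounded iM.
rewrite -[\int[P]_w X i w ^+ 2]mul1r.
rewrite -(integral_quadratic measurableT P1 _ _ _ (measurable_projection i) XC).
by apply: eq_integral => w _; congr EFin; ring.
Qed.

Lemma integral_projectionS i t : (i < M)%N ->
  let c := cos (theta i.+1) in
  let s2 := (N%:R - 1)^-1 * sin (theta i.+1) ^+ 2 in
  (\int[P]_w ((X i.+1 w + t) ^+ 2)%:E)%E =
  (t ^+ 2 + s2 + (2 * t * c * \int[P]_w X i w +
     (c ^+ 2 - s2) * \int[P]_w X i w ^+ 2))%:E.
Proof.
move=> iM c s2; have [_ uS /(_ i iM) [K [KS Kcond]]] := uC.
have msqr : measurable_fun setT (fun y : Rn R N => ((dot y u0 + t) ^+ 2)%:E).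
  apply/measurable_EFinP/measurable_funX/measurable_funD => //.
  exact: measurable_dot.
have sT (G : set (set Omega)) : <<s G >> setT.
  by have := sigma_algebraC (@sigma_algebra0 _ setT G); rewrite setC0.
rewrite (integral_conditional_law _ Kcond msqr); last 2 first.
- exact: sT.
- by move=> y; rewrite lee_fin sqr_ge0.
have [C XC] := projection_bounded (ltnW iM).
rewrite -(integral_quadratic measurableT P1 _ _ _ (measurable_projection i) XC).
apply: eq_integral => w _; have uw := uS i w (ltnW iM).
rewrite (integral_uniform_Sigma N2 _ _ uw (KS _ uw)) u0S (dotC u0).
by congr EFin; rewrite -/(X i w) -/c -/s2; ring.
Qed.

(** Both expressions of the mean of [(X i.+1 + t)^2] are polynomials in [t];
    [t = 0] yields the second moments, then [t = 1] the means. *)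
Lemma projection_momentsS i : (i < M)%N ->
  let c := cos (theta i.+1) in
  let s2 := (N%:R - 1)^-1 * sin (theta i.+1) ^+ 2 in
  \int[P]_w X i.+1 w = c * \int[P]_w X i w /\
  \int[P]_w X i.+1 w ^+ 2 = s2 + (c ^+ 2 - s2) * \int[P]_w X i w ^+ 2.
Proof.
move=> iM c s2.
have E t := esym (integral_projection_sqr t iM).
have [E0] := etrans (E 0) (integral_projectionS 0 iM).
have [E1] := etrans (E 1) (integral_projectionS 1 iM).
rewrite -/c -/s2 in E0 E1; split; lra.
Qed.

Lemma projection_moments0 :
  \int[P]_w X 0 w = 1 /\ \int[P]_w X 0 w ^+ 2 = 1.
Proof.
have X0 w : X 0 w = 1 by rewrite /X; have [-> _ _] := uC.
have one : \int[P]_(w in setT) (1 : R) = 1.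
  by rewrite Rintegral_cst// P1 mulr1.
split; rewrite -[RHS]one; apply: eq_Rintegral => w _; rewrite X0//.
by rewrite expr1n.
Qed.

Lemma projection_mean i : (i <= M)%N ->
  \int[P]_w X i w = \prod_(1 <= k < i.+1) cos (theta k).
Proof.
elim: i => [_|i IH iM]; first by rewrite big_nil; exact: projection_moments0.1.
by rewrite big_nat_recr//= -IH 1?ltnW// (projection_momentsS iM).1 mulrC.
Qed.

Lemma projection_expectation i : (i <= M)%N ->
  ('E_P[X i] = (\int[P]_w X i w)%:E)%E.
Proof.
move=> iM; have [C XC] := projection_bounded iM.
have iX := integrable_bounded P measurableT (measurable_projection i) XC.
rewrite unlock /Rintegral fineK//.
exact: (integrable_fin_num measurableT iX).
Qed.

Lemma projection_variance i : (i <= M)%N ->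
  ('V_P[X i] = (\int[P]_w X i w ^+ 2 - (\int[P]_w X i w) ^+ 2)%:E)%E.
Proof.
move=> iM; rewrite /variance unlock projection_expectation//=.
rewrite unlock; set m := \int[P]_w X i w.
transitivity (\int[P]_w ((X i w + - m) ^+ 2)%:E)%E.
  by apply: eq_integral => w _; rewrite expr2.
by rewrite integral_projection_sqr// -/m; congr EFin; ring.
Qed.

End chain.

(** * Solving the recursion *)

(** Write [c_i = a_i - n s_i], [C] and [A] for the products of the [c_i] and of
    the [a_i].  The recursion, solved from its fixed point [n / (1 + n)],
    gives [(1 + n) q_M = n + C], which is symmetric in the indices: this is why
    the formula may accumulate the factors [c_i] from the first step on,
    whereas the recursion accumulates them from the last.  Since
    [1 - c_j = (1 + n) s_j] and [a_j - c_j = n s_j], the two halves of the sum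
    telescope, to [n (1 - C) / (1 + n)] and [A - C]. *)
Lemma second_moment_recursion (R : realFieldType) (n : R) (a s q : nat -> R)
    (M : nat) :
  0 <= n -> (forall i, a i + s i = 1) -> q 0%N = 1 ->
  (forall i, (i < M)%N ->
     q i.+1 = n * s i.+1 + (a i.+1 - n * s i.+1) * q i) ->
  q M - \prod_(1 <= i < M.+1) a i =
  n * \sum_(1 <= j < M.+1)
    (s j * (1 - \prod_(j.+1 <= i < M.+1) a i) *
     \prod_(1 <= i < j) (a i - n * s i)).
Proof.
move=> n0 as1; have sE : s = fun i => 1 - a i.
  by apply/funext => i; rewrite -(as1 i) addrAC subrr add0r.
subst s => q0 qS /=.
pose C j := \prod_(1 <= i < j) (a i - n * (1 - a i)).
have CS j : C j.+2 = C j.+1 * (a j.+1 - n * (1 - a j.+1)).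
  by rewrite /C big_nat_recr.
have C1 : C 1%N = 1 by rewrite /C big_nil.
have qC : (1 + n) * q M = n + C M.+1.
  elim: {-2}M (leqnn M) => [_|i IH iM]; first by rewrite q0 C1; ring.
  rewrite qS// CS mulrDr [X in _ + X]mulrCA (IH (ltnW iM)); ring.
have sumC m : (1 + n) * (n * \sum_(1 <= j < m.+1) (1 - a j) * C j) =
    n * (1 - C m.+1).
  elim: m => [|m IH]; first by rewrite big_nil C1; ring.
  rewrite big_nat_recr//= CS mulrDr mulrDr IH; ring.
have sumA m : n * \sum_(1 <= j < m.+1)
      ((1 - a j) * (\prod_(j.+1 <= i < m.+1) a i) * C j) =
    \prod_(1 <= i < m.+1) a i - C m.+1.
  elim: m => [|m IH]; first by rewrite !big_nil C1; ring.
  rewrite big_nat_recr//= [X in (1 - a m.+1) * X]big_geq//.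
  rewrite [in RHS]big_nat_recr//= CS.
  have split_last j : (1 <= j < m.+1)%N ->
      (1 - a j) * (\prod_(j.+1 <= i < m.+2) a i) * C j =
      (1 - a j) * (\prod_(j.+1 <= i < m.+1) a i) * C j * a m.+1.
    by move=> /andP[_ jm]; rewrite big_nat_recr//=; ring.
  rewrite (eq_big_nat _ _ split_last) -mulr_suml mulrDr mulrA IH; ring.
apply: (@mulfI _ (1 + n)); first by rewrite gt_eqF// ltr_pwDl.
rewrite mulrBr qC -/(C _).
under [in RHS]eq_bigr do rewrite mulrBr mulr1 mulrBl -/(C _).
rewrite sumrB !mulrBr sumC sumA; ring.
Qed.

(** The factors [a_i - n s_i] lie between [- n] and [1], hence have absolute
    value at most 1. *)
Lemma variance_formula_le (R : realFieldType) (n : R) (a s : nat -> R)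
    (M : nat) :
  0 <= n <= 1 -> (forall i, 0 <= a i) -> (forall i, 0 <= s i) ->
  (forall i, a i + s i = 1) ->
  \sum_(1 <= j < M)
    (s j * (1 - \prod_(j.+1 <= i < M.+1) a i) *
     \prod_(1 <= i < j) (a i - n * s i)) <=
  \sum_(1 <= j < M) s j.
Proof.
move=> /andP[n0 n1] a0 s0 as1; apply: ler_sum => j _.
have a1 i : a i <= 1 by rewrite -(as1 i) lerDl.
set A := \prod_(_ <= _ < _) _; set C := \prod_(_ <= _ < _) _.
have A0 : 0 <= A by apply: prodr_ge0.
have A1 : A <= 1 by apply: prodr_ile1 => i _; rewrite a0 a1.
have C1 : C <= 1.
  rewrite (le_trans (ler_norm _))// normr_prod; apply: prodr_ile1 => i _.
  rewrite normr_ge0 ler_norml /=; move: (a0 i) (s0 i) (as1 i); nra.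
have AC : (1 - A) * C <= 1.
  by rewrite (le_trans (ler_wpM2l _ C1)) ?mulr1 ?subr_ge0// gerBl.
by rewrite -mulrA ler_piMr.
Qed.

Unset Implicit Arguments.

Theorem mainTheorem1 (R : realType) (N M : nat) (hN : (2 <= N)%N)
    (hM : (1 <= M)%N) (theta : nat -> R)
    (htheta : forall i : nat, (1 <= i <= M)%N -> 0 <= theta i <= pi)
    (u0 : 'rV[R]_N) (hu0 : sphere u0)
    (d : measure_display) (Omega : measurableType d)
    (P : probability Omega R) (u : nat -> {RV P >-> Rn R N})
    (hu : sphere_chain M theta u0 u) :
  let X : Omega -> R := fun w => dot (u M w) u0 in
  let sigma : \bar R := std_dev P X in
  [/\ ('E_P[X])%E = (\prod_(1 <= i < M.+1) cos (theta i))%:E,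
      (sigma ^+ 2)%E =
        ((N%:R - 1)^-1 *
         \sum_(1 <= j < M)
           (sin (theta j) ^+ 2 *
            (1 - \prod_(j.+1 <= i < M.+1) cos (theta i) ^+ 2) *
            \prod_(1 <= i < j)
              (cos (theta i) ^+ 2 - (N%:R - 1)^-1 * sin (theta i) ^+ 2)))%:E
    & (sigma <=
        ((Num.sqrt (N%:R - 1))^-1 *
         Num.sqrt (\sum_(1 <= j < M) sin (theta j) ^+ 2))%:E)%E].
Proof.
move=> X sigma; set n := (N%:R - 1)^-1.
pose a i := cos (theta i) ^+ 2; pose s i := sin (theta i) ^+ 2.
have as1 i : a i + s i = 1 by exact: cos2Dsin2.
have N1 : 1 <= N%:R - 1 :> R by rewrite lerBrDr -(natrD _ 1 1) ler_nat.
have n0 : 0 <= n by rewrite invr_ge0 (le_trans ler01).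
have n1 : n <= 1 by rewrite invf_le1// (lt_le_trans ltr01).
have mean := projection_mean hN hu0 hu (leqnn M).
have variance : ('V_P[X] = (n * \sum_(1 <= j < M)
    (s j * (1 - \prod_(j.+1 <= i < M.+1) a i) *
     \prod_(1 <= i < j) (a i - n * s i)))%:E)%E.
  rewrite (projection_variance hu (leqnn M)) mean -prodrXl; congr EFin.
  rewrite (@second_moment_recursion _ n a s
    (fun i => \int[P]_w dot (u i w) u0 ^+ 2) M n0 as1).
  (* the summand of index M vanishes: its product from M+1 to M is empty *)
  - rewrite big_nat_recr//= [X in _ * (1 - X)]big_geq// subrr mulr0 mul0r.
    by rewrite addr0.
  - exact: (projection_moments0 hu0 hu).2.
  - by move=> i iM; exact: (projection_momentsS hN hu0 hu iM).2.
split.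
- by rewrite (projection_expectation hu (leqnn M)) mean.
- by rewrite /sigma /std_dev sqr_sqrte ?variance_ge0// variance.
- rewrite /sigma /std_dev variance lee_fin -sqrtrV ?(le_trans ler01)//.
  rewrite -sqrtrM// ler_wsqrtr// ler_wpM2l//.
  apply: variance_formula_le as1; first by rewrite n0 n1.
  + by move=> i; exact: sqr_ge0.
  + by move=> i; exact: sqr_ge0.
Qed.
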